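(* For every integer $r\ge1$, let $M_r(z)=\sum_{\alpha\ne\varnothing}S(\alpha)^r z^{|\alpha|}$, the sum being over all nonempty integer compositions, and let $T(z)=\frac{1-z}{1-2z}$. Then, as formal power series, $$M_r(z)=T(z)\sum_{n\ge1}A_r(n)z^n,$$ where $$A_r(n)=\sum_{d\mid n}\bigl(n^r-(n-d)^r\bigr).$$ Equivalently, $$A_r(n)=\sum_{j=1}^{r}(-1)^{j+1}\binom{r}{j}n^{r-j}\sigma_j(n).$$
   Context: An integer composition of $n\ge1$ is an ordered sequence $\alpha=(a_1,\ldots,a_\ell)$ of integers $a_i\ge1$ with sum $n$; write $|\alpha|=n$. The initial run of $\alpha$ is the maximal prefix $(a_1,\ldots,a_k)$ whose entries are all equal; $P(\alpha)=a_1$, $K(\alpha)=k$ is the number of parts in it, and $S(\alpha)=P(\alpha)K(\alpha)$. For $j\ge0$, $\sigma_j(n)=\sum_{d\mid n}d^j$, summed over positive divisors $d$ of $n$. *)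

(* Defs.v *)
From HB Require Import structures.
From mathcomp Require Import all_boot all_order all_algebra.

Set Implicit Arguments.
Unset Strict Implicit.
Unset Printing Implicit Defensive.

Import GRing.Theory.

Local Open Scope ring_scope.

(* A formal power series is its sequence of coefficients; equality of formal
   power series is [=1] (no function extensionality involved). *)
Definition fps (R : Type) : Type := nat -> R.

Definition fps_of_poly (R : nzRingType) (p : {poly R}) : fps R := fun n => p`_n.

Definition fps_mul (R : nzRingType) (f g : fps R) : fps R :=
  fun n => \sum_(i < n.+1) f i * g (n - i)%N.

(* The coefficients 0, ..., n of 1 / f, obtained by solving f * g = 1 degree by
   degree; meaningful when f 0 is a unit, see [fps_mulV]. *)
Fixpoint fps_inv_upto (R : unitRingType) (f : fps R) (n : nat) : seq R :=
  if n is m.+1 then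
    let s := fps_inv_upto f m in
    rcons s (- ((f 0%N)^-1 * \sum_(i < n) f i.+1 * s`_(m - i)))
  else [:: (f 0%N)^-1].

Definition fps_inv (R : unitRingType) (f : fps R) : fps R :=
  fun n => (fps_inv_upto f n)`_n.

Definition fps_div (R : unitRingType) (f g : fps R) : fps R :=
  fps_mul f (fps_inv g).

Lemma size_fps_inv_upto (R : unitRingType) (f : fps R) n :
  size (fps_inv_upto f n) = n.+1.
Proof. by elim: n => //= n IHn; rewrite size_rcons IHn. Qed.

Lemma nth_fps_inv_upto (R : unitRingType) (f : fps R) n i :
  (i <= n)%N -> (fps_inv_upto f n)`_i = fps_inv f i.
Proof.
elim: n => [|n IHn]; first by rewrite leqn0 => /eqP->.
rewrite leq_eqVlt => /predU1P[->//|]; rewrite ltnS => le_in.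
by rewrite /= nth_rcons size_fps_inv_upto ltnS le_in IHn.
Qed.

Lemma fps_mulV (R : unitRingType) (f : fps R) :
  f 0%N \is a GRing.unit -> fps_mul f (fps_inv f) =1 fps_of_poly 1.
Proof.
move=> Uf0 [|n]; rewrite /fps_mul /fps_of_poly coef1.
  by rewrite big_ord1 /fps_inv /= mulrV.
rewrite big_ord_recl /= {1}/fps_inv /= nth_rcons size_fps_inv_upto ltnn eqxx.
rewrite mulrN mulrA mulrV // mul1r addrC; apply/eqP; rewrite subr_eq0; apply/eqP.
by apply: eq_bigr => i _; rewrite nth_fps_inv_upto ?leq_subr.
Qed.

(* The empty sequence is the empty composition, of weight 0; the weight |a| of
   a composition a is [sumn a]. *)
Definition is_composition (a : seq nat) : bool := all (leq 1) a.

(* A composition of n.+1 either starts with 1, or comes from a nonempty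
   composition of n by incrementing its first part. *)
Fixpoint compositions (n : nat) : seq (seq nat) :=
  if n is m.+1 then
    [seq 1%N :: s | s <- compositions m] ++
    [seq incr_nth s 0 | s <- compositions m & s != [::]]
  else [:: [::]].

Lemma mem_compositions n a :
  (a \in compositions n) = is_composition a && (sumn a == n).
Proof.
rewrite /is_composition; elim: n a => [|n IHn] a.
  by rewrite inE; case: a => [|[|x] a] //=; rewrite andbF.
rewrite [compositions _]/= mem_cat; apply/orP/andP => [[/mapP[s]|/mapP[s]]|[]].
- by rewrite IHn => /andP[cs /eqP<-] ->; rewrite /= cs.
- rewrite mem_filter IHn; case: s => [|x s] //= /andP[/andP[_ cs] /eqP<-] ->.
  by split=> //=; rewrite addSn.
case: a => [|[|[|x]] a] //= ca.
  by rewrite add1n eqSS => sa; left; apply: map_f; rewrite IHn sa andbT.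
rewrite addSn eqSS => sa; right; apply/mapP; exists (x.+1 :: a) => //.
by rewrite mem_filter IHn /= sa andbT.
Qed.

Lemma compositions_uniq n : uniq (compositions n).
Proof.
elim: n => //= n IHn; rewrite cat_uniq map_inj_uniq ?IHn; last by move=> s t [].
rewrite map_inj_in_uniq ?filter_uniq //= ?andbT; last first.
  move=> s t; rewrite !mem_filter => /andP[+ _] /andP[+ _].
  by case: s t => [|x s] [|y t] //= _ _ [-> ->].
apply/hasPn => a /mapP[s]; rewrite mem_filter mem_compositions.
case: s => [|[|x] s] //= _ ->.
by apply/negP => /mapP[t _].
Qed.

(* [find] returns the size of the whole sequence when all parts are equal. *)
Definition initial_run (a : seq nat) : seq nat :=
  take (find (predC1 (head 0%N a)) a) a.

Definition P_ (a : seq nat) : nat := head 0%N a.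

Definition K_ (a : seq nat) : nat := size (initial_run a).

Definition S_ (a : seq nat) : nat := (P_ a * K_ a)%N.

(* The coefficient of z^n is the finite sum over the nonempty compositions
   of weight n. *)
Definition M_ (r : nat) : fps int :=
  fun n => \sum_(a <- compositions n | a != [::]) (S_ a)%:Z ^+ r.

Definition T_ : fps int :=
  fps_div (fps_of_poly (1 - 'X)) (fps_of_poly (1 - 2 *: 'X)).

Definition sigma_ (j n : nat) : nat := (\sum_(d <- divisors n) d ^ j)%N.

Definition A_ (r n : nat) : int :=
  \sum_(d <- divisors n) (n%:Z ^+ r - (n%:Z - d%:Z) ^+ r).

(* The series \sum_(n >= 1) u n z^n. *)
Definition fps_from1 (R : nzRingType) (u : nat -> R) : fps R :=
  fun n => if (1 <= n)%N then u n else 0.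

(* Main.v *)
Require Import Defs.
From mathcomp Require Import all_boot all_order all_algebra.
From mathcomp Require Import ring.

(** Fix a nonempty composition [a] of [n] with first part [p] and an initial
    run of length [k].  Since [r >= 1], telescoping along the run gives
      S(a)^r = (p k)^r = \sum_(1 <= i <= k) ((p i)^r - (p i - p)^r),
    so [S(a)^r] is the sum of the weights [m^r - (m - d)^r] over all pairs
    [d %| m] such that [a] begins with [m / d] copies of [d]: this forces
    [d = p] and [m = p i] with [i <= k] ([expn_S_prefix_sum]).

    Summing over all [a] and exchanging the sums, the pair [(m, d)] contributes
    its weight once for each composition of [n] that begins with a given
    sequence of sum [m].  Such a composition is that sequence followed by an
    arbitrary composition of [n - m] ([count_prefix_compositions]); their number
    does not depend on [d], and the weights with the same [m] add up to
    [A_ r m].  Hence [M_ r] is the convolution of [A_ r] with the counting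
    sequence of compositions, whose generating series is [T_] ([T_coef]).

    The second formula for [A_ r] is the binomial expansion of [(n - d)^r],
    summed over the divisors [d] of [n]. *)

Import GRing.Theory.

Local Open Scope ring_scope.

(** * The generating series of compositions *)

Lemma size_compositionsS n : size (compositions n.+1) = (2 ^ n)%N.
Proof.
elim: n => [//|n IHn]; rewrite [compositions _]/= size_cat !size_map.
have /all_filterP-> : all (fun s => s != [::]) (compositions n.+1).
  by apply/allP => s; rewrite mem_compositions; case: s.
by rewrite IHn addnn expnS mul2n.
Qed.

(** Comparing coefficients in [(1 - 2z) g = 1] gives [g_(n+1) = 2 g_n]. *)
Lemma fps_inv_geometric n :
  fps_inv (fps_of_poly (1 - 2 *: 'X : {poly int})) n = 2 ^+ n.
Proof.
set f := fps_of_poly _.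
have fE i : f i = (i == 0%N)%:R - 2 * (i == 1%N)%:R.
  by rewrite /f /fps_of_poly coefB coef1 coefZ coefX.
have f0 : f 0%N = 1 by rewrite fE.
have fV : f 0%N \is a GRing.unit by rewrite f0 unitr1.
elim: n => [|n IHn]; first by rewrite /fps_inv /= f0 invr1.
have := fps_mulV fV n.+1.
rewrite /fps_mul /fps_of_poly coef1 big_ord_recl big_ord_recl /= big1 => [|i _].
  rewrite f0 !fE /= !subn0 subSS subn0 IHn mul1r addr0 sub0r mulr1 mulNr.
  by move/eqP; rewrite subr_eq0 exprS => /eqP.
by rewrite fE /= mulr0 subr0 mul0r.
Qed.

Lemma T_coef n : T_ n = (size (compositions n))%:Z.
Proof.
have pE i : fps_of_poly (1 - 'X : {poly int}) i
    = (i == 0%N)%:R - (i == 1%N)%:R.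
  by rewrite /fps_of_poly coefB coef1 coefX.
rewrite /T_ /fps_div /fps_mul; case: n => [|n].
  by rewrite big_ord1 pE fps_inv_geometric.
rewrite big_ord_recl big_ord_recl /= big1 => [|i _].
  rewrite !pE !fps_inv_geometric /= subn0 subSS subn0 size_compositionsS.
  by rewrite subr0 sub0r mul1r mulN1r addr0 exprS mulr2n mulrDl mul1r addrK
             -[RHS]natz natrX.
by rewrite pE /= subr0 mul0r.
Qed.

(** * Compositions with a prescribed beginning *)

(** Removing the prefix [s] is a bijection onto the compositions of
    [n - sumn s]. *)
Lemma count_prefix_compositions (s : seq nat) n :
  is_composition s -> (sumn s <= n)%N ->
  count (prefix s) (compositions n) = size (compositions (n - sumn s)).
Proof.
move=> cs le_sn; rewrite -size_filter -(size_map (cat s)).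
apply/perm_size/uniq_perm; first by rewrite filter_uniq ?compositions_uniq.
  rewrite map_inj_uniq ?compositions_uniq // => t u /eqP.
  by rewrite eqseq_cat // eqxx => /eqP.
move=> a; rewrite mem_filter mem_compositions.
apply/idP/mapP => [/and3P[/prefixP[t ->]]|[t + ->]].
  rewrite /is_composition all_cat sumn_cat => /andP[_ ct] /eqP<-.
  by exists t; rewrite // mem_compositions /is_composition ct addKn eqxx.
rewrite mem_compositions => /andP[ct /eqP st].
by rewrite prefix_prefix /is_composition all_cat [all _ s]cs [all _ t]ct sumn_cat
           st subnKC // eqxx.
Qed.

Lemma prefix_nseq (d k : nat) (a : seq nat) :
  prefix (nseq k d) a = (k <= find (predC1 d) a)%N.
Proof.
elim: a k => [|x a IHa] [|k] //=.
by rewrite IHa eq_sym; case: (x == d).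
Qed.

Lemma mul_find_le_sumn (d : nat) (a : seq nat) :
  (d * find (predC1 d) a <= sumn a)%N.
Proof.
elim: a => [|x a IHa] /=; first by rewrite muln0.
by case: eqP => [->|_] /=; rewrite ?muln0 // mulnS leq_add2l.
Qed.

Lemma S_find (a : seq nat) :
  S_ a = (head 0 a * find (predC1 (head 0 a)) a)%N.
Proof. by rewrite /S_ /P_ /K_ /initial_run size_takel ?find_size. Qed.

(** The summand is the jump of [G m = (p * minn (m %/ p) k) ^+ r] at the first
    [k] positive multiples of [p], and [G] is constant elsewhere; so the sum
    is [G n - G 0]. *)
Lemma telescope_multiples (r p k n : nat) :
  (0 < r)%N -> (0 < p)%N -> (p * k <= n)%N ->
  \sum_(1 <= m < n.+1 | (p %| m)%N && (m %/ p <= k)%N)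
     (m%:Z ^+ r - (m%:Z - p%:Z) ^+ r) = (p * k)%:Z ^+ r.
Proof.
move=> r0 p0 le_pk.
pose G m : int := (p * minn (m %/ p) k)%:Z ^+ r.
have -> : (p * k)%:Z ^+ r = G n - G 0%N.
  rewrite /G div0n min0n muln0 expr0n (gtn_eqF r0) subr0.
  by rewrite (minn_idPr _) // leq_divRL // mulnC.
rewrite -telescope_sumr // big_add1 /= big_mkcond /=.
apply: eq_bigr => m _; rewrite /G divnS //.
case: (boolP (p %| m.+1)%N) => [dvd_p|_]; last by rewrite add0n subrr.
have mE : (p * (m %/ p).+1)%N = m.+1.
  by rewrite -[in RHS](divnK dvd_p) divnS // dvd_p mulnC.
rewrite add1n; case: (ltnP (m %/ p) k) => [lt_k|ge_k] /=.
  rewrite (minn_idPl lt_k) mE.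
  by rewrite -mE mulnS PoszD [p%:Z + _]addrC addrK.
by rewrite (minn_idPr (leqW ge_k)) subrr.
Qed.

(** Only [d = head 0 a] contributes, since [m %/ d] is positive. *)
Lemma expn_S_prefix_sum (r n : nat) (a : seq nat) :
  (0 < r)%N -> a \in compositions n -> a != [::] ->
  (S_ a)%:Z ^+ r =
    \sum_(1 <= m < n.+1) \sum_(d <- divisors m | prefix (nseq (m %/ d) d) a)
      (m%:Z ^+ r - (m%:Z - d%:Z) ^+ r).
Proof.
rewrite mem_compositions => r0 /andP[ca /eqP<-] nz_a; rewrite S_find.
set p := head 0%N a; have p0 : (0 < p)%N.
  by rewrite /p; case: (a) ca nz_a => //= x s /andP[].
rewrite -(telescope_multiples r p _ (sumn a) r0 p0) ?mul_find_le_sumn //.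
rewrite big_mkcond; apply: eq_big_nat => m /andP[m0 _].
have dm d : d \in divisors m -> prefix (nseq (m %/ d) d) a -> d = p.
  rewrite -dvdn_divisors // => dv_d; have d0 := dvdn_gt0 m0 dv_d.
  have: (0 < m %/ d)%N by rewrite divn_gt0 // dvdn_leq.
  case: (m %/ d)%N => // k _; rewrite /p.
  by case: (a) => [|x s] //= /andP[/eqP].
rewrite dvdn_divisors //; case: (boolP (p \in divisors m)) => [p_m|p_m] /=.
  rewrite big_mkcond (bigD1_seq p) ?divisors_uniq //= prefix_nseq.
  rewrite big_seq_cond big1 ?addr0 // => d /andP[d_m ne_dp].
  by case: ifP => // /(dm _ d_m) d_p; rewrite d_p eqxx in ne_dp.
rewrite big_seq_cond big1 // => d /andP[d_m pre_d].
by rewrite -(dm d d_m pre_d) d_m in p_m.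
Qed.

(** * The two formulas *)

Lemma M_coef (r n : nat) : (0 < r)%N ->
  M_ r n = \sum_(1 <= m < n.+1) (size (compositions (n - m)))%:Z * A_ r m.
Proof.
move=> r0; rewrite /M_.
transitivity (\sum_(a <- compositions n) \sum_(1 <= m < n.+1)
    \sum_(d <- divisors m | prefix (nseq (m %/ d) d) a)
      (m%:Z ^+ r - (m%:Z - d%:Z) ^+ r)).
  rewrite big_mkcond; apply: eq_big_seq => a a_n.
  case: ifPn => [nz_a|/negPn/eqP a0]; first exact: expn_S_prefix_sum.
  move: a_n; rewrite a0 mem_compositions => /eqP <- /=.
  by rewrite big_geq.
rewrite exchange_big; apply: eq_big_nat => m /andP[m0 le_mn].
under eq_bigr do rewrite big_mkcond.
rewrite exchange_big /A_ mulr_sumr; apply: eq_big_seq => d.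
rewrite -dvdn_divisors //= => dv_d; have d0 := dvdn_gt0 m0 dv_d.
have sum_d : sumn (nseq (m %/ d) d) = m by rewrite sumn_nseq mulnC divnK.
rewrite -big_mkcond big_const_seq iter_addr_0 count_prefix_compositions ?sum_d //.
  by rewrite -mulr_natl natz.
by rewrite /is_composition all_nseq d0 orbT.
Qed.

Lemma A_binomial (r n : nat) :
  A_ r n = \sum_(1 <= j < r.+1)
    (-1) ^+ (j + 1) * 'C(r, j)%:Z * n%:Z ^+ (r - j) * (sigma_ j n)%:Z.
Proof.
transitivity (\sum_(d <- divisors n) \sum_(1 <= j < r.+1)
    (-1) ^+ (j + 1) * 'C(r, j)%:Z * n%:Z ^+ (r - j) * (d%:Z ^+ j)).
  apply: eq_bigr => d _.
  rewrite exprBn big_ord_recl /= expr0 subn0 bin0 mul1r mulr1 mulr1n.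
  rewrite opprD addrA subrr add0r -sumrN big_add1 /= big_mkord.
  apply: eq_bigr => i _; rewrite /bump /= add1n addn1 -mulr_natr natz.
  by rewrite !exprS; ring.
rewrite exchange_big; apply: eq_bigr => j _.
rewrite -mulr_sumr /sigma_ -[X in _ = _ * X]natz natr_sum.
by congr (_ * _); apply: eq_bigr => d _; rewrite natrX natz.
Qed.

Theorem theorem7p1 (r : nat) (hr : (1 <= r)%N) :
  M_ r =1 fps_mul T_ (fps_from1 (A_ r)) /\
  (forall n : nat, (1 <= n)%N ->
     A_ r n = \sum_(1 <= j < r.+1)
       (-1) ^+ (j + 1) * 'C(r, j)%:Z * n%:Z ^+ (r - j) * (sigma_ j n)%:Z).
Proof.
split=> [n|n _]; last exact: A_binomial.
rewrite M_coef // /fps_mul.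
rewrite (reindex_inj rev_ord_inj) big_ord_recl /= subSS subn0 subnn.
rewrite [fps_from1 _ 0%N]/= mulr0 add0r big_add1 /= big_mkord.
apply: eq_bigr => i _.
by rewrite /bump add1n subSS T_coef subKn.
Qed.
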